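(* Let $\Omega\subset\mathbb{R}^N$ be a bounded domain with Lipschitz boundary, $0<s<1$, $1<p<\infty$, $N>ps$, $0<\gamma<1$, $\lambda>0$, $p_s^*=\frac{Np}{N-ps}$, and let $\mathfrak{M}:[0,\infty)\to[0,\infty)$ satisfy, with $\mathcal{M}(t)=\int_0^t\mathfrak{M}(\tau)\,d\tau$: (m1) $\mathfrak{M}$ is continuous and there is $\theta\in(1,p_s^*/p)$ such that $t\mathfrak{M}(t)\le\theta\mathcal{M}(t)$ for all $t\ge0$; (m2) there is $\mathfrak{m}_0>0$ such that $\mathfrak{M}(t)\ge\mathfrak{m}_0t^{\theta-1}$ for all $t\in[0,1]$; (m3) for every $\tau>0$ there is $\kappa=\kappa(\tau)>0$ such that $\mathfrak{M}(t)\ge\kappa$ for all $t\ge\tau$. If $u\in X_0$ is a positive weak solution of $$\mathfrak{M}(\|u\|^p)(-\Delta)_p^su=\frac{\lambda}{|u|^{\gamma-1}u}+|u|^{p_s^*-2}u\ \text{ in }\Omega,\qquad u>0\ \text{ in }\Omega,\qquad u=0\ \text{ in }\mathbb{R}^N\setminus\Omega,$$ then $u\in L^\infty(\overline{\Omega})$.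
   Context: Let $N\ge 2$, $Q=\mathbb{R}^{2N}\setminus\big((\mathbb{R}^N\setminus\Omega)\times(\mathbb{R}^N\setminus\Omega)\big)$. $X_0$ is the space of measurable $u:\mathbb{R}^N\to\mathbb{R}$ with $u|_\Omega\in L^p(\Omega)$, $\frac{|u(x)-u(y)|}{|x-y|^{(N+ps)/p}}\in L^p(Q)$ and $u=0$ a.e. in $\mathbb{R}^N\setminus\Omega$, with norm $\|u\|=\left(\int_Q\frac{|u(x)-u(y)|^p}{|x-y|^{N+ps}}\,dx\,dy\right)^{1/p}$. The fractional $p$-Laplacian is understood weakly: $\langle(-\Delta)_p^su,\varphi\rangle=\int_Q\frac{|u(x)-u(y)|^{p-2}(u(x)-u(y))(\varphi(x)-\varphi(y))}{|x-y|^{N+ps}}\,dx\,dy$. A function $u\in X_0$ is a weak solution if for every $\varphi\in X_0$ one has $\varphi u^{-\gamma}\in L^1(\Omega)$ and $$\mathfrak{M}(\|u\|^p)\langle(-\Delta)_p^su,\varphi\rangle-\int_\Omega\frac{\lambda}{|u|^{\gamma-1}u}\varphi\,dx-\int_\Omega|u|^{p_s^*-2}u\varphi\,dx=0.$$ *)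

(* Defs.v *)
From HB Require Import structures.
From mathcomp Require Import all_boot all_order all_algebra.
From mathcomp Require Import all_classical all_reals all_analysis.

Set Implicit Arguments.
Unset Strict Implicit.
Unset Printing Implicit Defensive.
Import Order.TTheory GRing.Theory Num.Theory.
Import numFieldNormedType.Exports.
Local Open Scope classical_set_scope.
Local Open Scope ring_scope.

(* Row vectors with the Borel (product) sigma-algebra, generated by the
   coordinate maps as the library does for [n.-tuple T]. *)
Definition bRn (R : realType) (n : nat) := 'rV[R]_n.

Section borel_Rn.
Context (R : realType) (n : nat).

HB.instance Definition _ := NormedModule.on (bRn R n).

Let coors : 'I_n -> bRn R n -> measurableTypeR R := fun i v => v ord0 i.

Let bRn_set0 : g_sigma_preimage coors set0.
Proof. exact: sigma_algebra0. Qed.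

Let bRn_setC A : g_sigma_preimage coors A -> g_sigma_preimage coors (~` A).
Proof. exact: sigma_algebraC. Qed.

Let bRn_bigcup (F : (set (bRn R n))^nat) :
  (forall i, g_sigma_preimage coors (F i)) ->
  g_sigma_preimage coors (\bigcup_i (F i)).
Proof. exact: sigma_algebra_bigcup. Qed.

HB.instance Definition _ := @isMeasurable.Build default_measure_display
  (bRn R n) (g_sigma_preimage coors) bRn_set0 bRn_setC bRn_bigcup.

Lemma measurable_bRn_coord (i : 'I_n) :
  measurable_fun [set: bRn R n] (fun v => v ord0 i : measurableTypeR R).
Proof.
move=> _ A mA; rewrite setTI; apply: sub_sigma_algebra.
by rewrite (bigD1 i)//=; left; exists A => //; rewrite setTI.
Qed.

Lemma measurable_fun_bRn d (T : measurableType d) (f : T -> bRn R n) :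
  (forall i, measurable_fun setT (fun x => f x ord0 i : measurableTypeR R)) ->
  measurable_fun setT f.
Proof.
move=> mf; apply: (@measurability _ _ _ _ _ f
  (\big[setU/set0]_(i < n) preimage_set_system setT (coors i) measurable)) => //.
move=> _ [B + <-]; apply: (big_ind (fun X : set (set _) =>
  X B -> measurable (setT `&` f @^-1` B))).
- by [].
- by move=> X Y HX HY [/HX|/HY].
- move=> i _ [A mA <-].
  rewrite !setTI.
  by have := mf i measurableT A mA; rewrite setTI.
Qed.

End borel_Rn.

Lemma product_sigma_finite d1 d2 (T1 : measurableType d1)
    (T2 : measurableType d2) (R : realType)
    (m1 : {sigma_finite_measure set T1 -> \bar R})
    (m2 : {sigma_finite_measure set T2 -> \bar R}) :
  sigma_finite setT (m1 \x m2)%E.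
Proof.
have /sigma_finiteP[F [TF ndF Foo]] := sigma_finiteT m1.
have /sigma_finiteP[G [TG ndG Goo]] := sigma_finiteT m2.
exists (fun n => F n `*` G n).
  rewrite -setXTT TF TG predeqE => -[x y]; split.
    move=> [/= [n _ Fnx] [k _ Gky]]; exists (maxn n k) => //; split.
    - by move: x Fnx; exact/subsetPset/ndF/leq_maxl.
    - by move: y Gky; exact/subsetPset/ndG/leq_maxr.
  by move=> [n _ []/= ? ?]; split; exists n.
move=> k; have [? ?] := Foo k; have [? ?] := Goo k.
split; first exact: measurableX.
by rewrite product_measure1E// lte_mul_pinfty// ge0_fin_numE.
Qed.

Section lebesgue_bRn.
Context (R : realType).

Definition bRn_cons (n : nat) (z : measurableTypeR R * bRn R n) : bRn R n.+1 :=
  \row_i (if unlift ord0 i is Some j then z.2 ord0 j else z.1).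

Definition bRn_uncons (n : nat) (v : bRn R n.+1) : measurableTypeR R * bRn R n :=
  (v ord0 ord0, \row_j v ord0 (lift ord0 j)).

Lemma bRn_uncons_cons n : cancel (@bRn_cons n) (@bRn_uncons n).
Proof.
move=> [x v]; congr pair; first by rewrite mxE unlift_none.
by apply/rowP => j; rewrite !mxE liftK.
Qed.

Lemma measurable_bRn_cons n : measurable_fun setT (@bRn_cons n).
Proof.
apply: measurable_fun_bRn => i.
case: (unliftP ord0 i) => [j ->|->].
  rewrite (_ : (fun x => _) = (fun v : bRn R n => v ord0 j : measurableTypeR R) \o snd).
    exact: measurableT_comp (measurable_bRn_coord j) measurable_snd.
  by apply/funext => z; rewrite mxE liftK.
rewrite (_ : (fun x => _) = fst); first exact: measurable_fst.
by apply/funext => z; rewrite mxE unlift_none.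
Qed.

Lemma measurable_bRn_uncons n : measurable_fun setT (@bRn_uncons n).
Proof.
apply/measurable_fun_pairP; split; first exact: measurable_bRn_coord.
apply: measurable_fun_bRn => i.
rewrite (_ : (fun x => _) = (fun v : bRn R n.+1 => v ord0 (lift ord0 i) : measurableTypeR R)).
  exact: measurable_bRn_coord.
by apply/funext => z; rewrite mxE.
Qed.

(* N-fold product of the one-dimensional Lebesgue measure on Borel sets. *)
Fixpoint borel_lebesgue (n : nat) : set (bRn R n) -> \bar R :=
  match n with
  | 0 => dirac (0 : bRn R 0)
  | m.+1 =>
    pushforward (lebesgue_measure \x @borel_lebesgue m)%E (@bRn_cons m)
  end.

Lemma borel_lebesgue_sigma_finite_measure n :
  exists m : {sigma_finite_measure set (bRn R n) -> \bar R},
    m = @borel_lebesgue n :> (set (bRn R n) -> \bar R).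
Proof.
elim: n => [|n [m mE]]; first by exists (\d_(0 : bRn R 0)).
pose nu : {measure set (measurableTypeR R * bRn R n)%type -> \bar R} :=
  (lebesgue_measure \x m)%E.
pose f : set (bRn R n.+1) -> \bar R := pushforward nu (@bRn_cons n).
have f0 : f set0 = 0%E by rewrite /f /pushforward preimage_set0 measure0.
have f_ge0 A : (0 <= f A)%E by exact: (measure_ge0 nu).
have f_add : semi_sigma_additive f.
  exact: (@measure_semi_sigma_additive _ _ _
    (measure_function_pushforward__canonical__measure_function_Measure
       nu (@measurable_bRn_cons n))).
have f_fin : sigma_finite setT f.
  have [F FT mF] := product_sigma_finite (@lebesgue_measure R) m.
  exists (fun k => @bRn_uncons n @^-1` F k).
    by rewrite -preimage_bigcup -FT preimage_setT.
  move=> k; have [mFk Fk] := mF k; split.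
    by rewrite -[X in measurable X]setTI; exact: measurable_bRn_uncons.
  rewrite /f /pushforward -comp_preimage (_ : _ \o _ = id) ?preimage_id//.
  by apply/funext => z; exact: bRn_uncons_cons.
pose fm := isMeasure.Build _ _ _ f f0 f_ge0 f_add.
pose fM : {measure set (bRn R n.+1) -> \bar R} := HB.pack f fm.
pose ff := Measure_isSigmaFinite.Build _ _ _ fM f_fin.
pose g : {sigma_finite_measure set (bRn R n.+1) -> \bar R} :=
  HB.pack (Measure.sort fM) ff.
by exists g; rewrite /= -mE.
Qed.

Let bl_ex n := cid (borel_lebesgue_sigma_finite_measure n).

Let bl0 n : @borel_lebesgue n set0 = 0%E.
Proof. by rewrite -(projT2 (bl_ex n)) measure0. Qed.

Let bl_ge0 n A : (0 <= @borel_lebesgue n A)%E.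
Proof. by rewrite -(projT2 (bl_ex n)). Qed.

Let bl_sigma_additive n : semi_sigma_additive (@borel_lebesgue n).
Proof. rewrite -(projT2 (bl_ex n)); exact: measure_semi_sigma_additive. Qed.

Let bl_sigma_finite n : sigma_finite setT (@borel_lebesgue n).
Proof. rewrite -(projT2 (bl_ex n)); exact: sigma_finiteT. Qed.

HB.instance Definition _ n := isMeasure.Build _ _ _ (@borel_lebesgue n)
  (@bl0 n) (@bl_ge0 n) (@bl_sigma_additive n).
HB.instance Definition _ n := Measure_isSigmaFinite.Build _ _ _
  (@borel_lebesgue n) (@bl_sigma_finite n).

End lebesgue_bRn.

(* Row vectors with the sigma-algebra of Lebesgue (Caratheodory) measurable
   sets. *)
Definition Rn (R : realType) (n : nat) := 'rV[R]_n.

Section lebesgue_Rn.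
Context (R : realType) (n : nat).

HB.instance Definition _ := NormedModule.on (Rn R n).

HB.instance Definition _ := Measurable.copy (Rn R n)
  (caratheodory_type ((@borel_lebesgue R n)^*)%mu).

Definition lebesgue_Rn : set (Rn R n) -> \bar R :=
  @completed_measure_extension _ _ _ (@borel_lebesgue R n).

HB.instance Definition _ := Measure.on lebesgue_Rn.

Let lebesgue_Rn_sigma_finite : sigma_finite setT lebesgue_Rn.
Proof. exact/completed_measure_extension_sigma_finite/sigma_finiteT. Qed.

HB.instance Definition _ := Measure_isSigmaFinite.Build _ _ _ lebesgue_Rn
  lebesgue_Rn_sigma_finite.

End lebesgue_Rn.
Arguments lebesgue_Rn {R n}.

Section euclidean.
Context (R : realType) (N : nat).
Implicit Types x y z e : Rn R N.

Definition dotRn x y : R := \sum_(i < N) x ord0 i * y ord0 i.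

(* The norm `|x| that the library puts on row vectors is the maximum norm;
   it is used below only through the topology and boundedness. *)
Definition enorm x : R := Num.sqrt (dotRn x x).

Definition boundary (A : set (Rn R N)) := closure A `\` interior A.

Definition bounded_domain (Omega : set (Rn R N)) :=
  [/\ Omega !=set0, open Omega, connected Omega & bounded_set Omega].

(* Near each boundary point, Omega is the strict epigraph of a Lipschitz
   function in suitably rotated coordinates. The unit vector e is the direction
   of the last rotated axis, the hyperplane orthogonal to e carries the other
   ones: x has coordinates (x - (x . e) e, x . e). *)
Definition lipschitz_boundary (Omega : set (Rn R N)) :=
  forall x0, boundary Omega x0 ->
  exists (r L : R) (e : Rn R N) (g : Rn R N -> R),
  [/\ 0 < r, enorm e = 1,
      forall y z, dotRn y e = 0 -> dotRn z e = 0 ->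
        `|g y - g z| <= L * enorm (y - z) &
      forall x, enorm (x - x0) < r ->
        (Omega x <-> g (x - dotRn x e *: e) < dotRn x e)].

End euclidean.

(* f restricted to D belongs to L^q(D), f being extended by 0 outside D. *)
Definition Lfun_on d (T : measurableType d) (R : realType)
    (mu : {measure set T -> \bar R}) (q : \bar R) (D : set T) (f : T -> R) :=
  (f \_ D) \in Lfun mu q.

Section fractional_p_laplacian.
Context (R : realType) (N : nat) (Omega : set (Rn R N)) (s p : R).
Implicit Types u phi : Rn R N -> R.

Definition lebesgue_Rn2 : {measure set (Rn R N * Rn R N)%type -> \bar R} :=
  (lebesgue_Rn \x lebesgue_Rn)%E.

Definition Qset : set (Rn R N * Rn R N) := ~` (~` Omega `*` ~` Omega).

Definition X0 u :=
  [/\ measurable_fun setT u,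
      Lfun_on lebesgue_Rn p%:E Omega u,
      Lfun_on lebesgue_Rn2 p%:E Qset (fun z =>
        `|u z.1 - u z.2| / enorm (z.1 - z.2) `^ ((N%:R + p * s) / p)) &
      {ae lebesgue_Rn, forall x, ~ Omega x -> u x = 0}].

Definition X0norm u : R :=
  (\int[lebesgue_Rn2]_(z in Qset)
    (`|u z.1 - u z.2| `^ p / enorm (z.1 - z.2) `^ (N%:R + p * s))) `^ p^-1.

(* At the points where u z.1 = u z.2 the integrand is 0, also when p < 2. *)
Definition plap_pairing u phi : R :=
  \int[lebesgue_Rn2]_(z in Qset)
    (`|u z.1 - u z.2| `^ (p - 2) * (u z.1 - u z.2) * (phi z.1 - phi z.2)
     / enorm (z.1 - z.2) `^ (N%:R + p * s)).

Definition critical_exponent : R := N%:R * p / (N%:R - p * s).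

Definition weak_solution (M : R -> R) (gamma lambda : R) u :=
  X0 u /\ forall phi, X0 phi ->
    Lfun_on lebesgue_Rn 1%E Omega (fun x => phi x * u x `^ (- gamma)) /\
    M (X0norm u `^ p) * plap_pairing u phi
    - \int[lebesgue_Rn]_(x in Omega)
        (lambda / (`|u x| `^ (gamma - 1) * u x) * phi x)
    - \int[lebesgue_Rn]_(x in Omega)
        (`|u x| `^ (critical_exponent - 2) * u x * phi x) = 0.

End fractional_p_laplacian.

Definition primitive0 (R : realType) (M : R -> R) (t : R) : R :=
  \int[lebesgue_measure]_(tau in `[0, t]) M tau.

(* Main.v *)
(* Put q = p_s^* and A(k) = \int (u - k)_+^q. For h < k one has
   u <= k / (k - h) (u - h) on {u > k}, and for k >= 1 the singular term is at
   most lambda u^(q-1) there, so testing the equation with (u - k)_+ gives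
     M(|u|^p) [(u - k)_+]^p <= (lambda + 1) (k / (k - h))^q A(h).
   The fractional Sobolev inequality turns the left-hand side into
   A(k)^(p/q), and since q / p > 1 De Giorgi's iteration along
   k_n = K (2 - 2^-n) gives A(2K) = 0 as soon as A(K) is small, which holds for
   K large because u is in L^q: no preliminary gain of integrability is needed
   at the critical exponent. If M(|u|^p) = 0, then (m3) forces |u| = 0.

   The Sobolev inequality follows, after truncation, from the pointwise bound
     w(x)^q <= C (\int w^q)^(ps/N) \int |w(x) - w(y)|^p / |x - y|^(N+ps) dy
   by integrating in x and absorbing the power of \int w^q. *)

Require Import Defs.
From HB Require Import structures.
From mathcomp Require Import all_boot all_order all_algebra.
From mathcomp Require Import all_classical all_reals all_analysis.
From mathcomp Require Import measurable_realfun ess_sup_inf ring lra.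

Set Implicit Arguments.
Unset Strict Implicit.
Unset Printing Implicit Defensive.
Import Order.TTheory GRing.Theory Num.Theory.
Import numFieldNormedType.Exports.
Local Open Scope classical_set_scope.
Local Open Scope ring_scope.

(** * Lebesgue measure of cubes *)

Section Rn_measurability.
Context (R : realType) (N : nat).
Implicit Types (x y : Rn R N) (A : set (Rn R N)).

Lemma Rn_borel_measurable A :
  measurable (A : set (bRn R N)) -> measurable A.
Proof. exact: caratheodory_measurable_mu_ext. Qed.

Lemma measurable_Rn_coord (i : 'I_N) :
  measurable_fun [set: Rn R N] (fun v : Rn R N => v ord0 i).
Proof.
move=> _ A mA; rewrite setTI; apply: Rn_borel_measurable.
by have := measurable_bRn_coord i measurableT mA; rewrite setTI.
Qed.

(** Written coordinatewise so that it splits as a product along the first axis. For [0 < r] it is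
    the open ball of the maximum norm. *)
Definition cube x (r : R) : set (Rn R N) :=
  [set y | forall i, `|x ord0 i - y ord0 i| < r].

Lemma bRn_cube_measurable x r : measurable (cube x r : set (bRn R N)).
Proof.
rewrite (_ : cube x r = \bigcap_(i in [set: 'I_N])
    ((fun v : bRn R N => v ord0 i) @^-1` ball (x ord0 i) r)); last first.
  by apply/seteqP; split => y /= yr i; [move=> _; exact: yr|exact: (yr i I)].
apply: fin_bigcap_measurable; first exact: finite_finset.
move=> i _; rewrite -[X in measurable X]setTI.
by apply: measurable_bRn_coord => //; exact: measurable_ball.
Qed.

Lemma cube_measurable x r : measurable (cube x r).
Proof. exact: Rn_borel_measurable (bRn_cube_measurable _ _). Qed.

Lemma cubeE x (r : R) : 0 < r -> cube x r = ball x r.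
Proof.
move=> r0; apply/seteqP; split => y.
  by move=> xyr; split => // i j; rewrite (ord1 i); exact: xyr.
by move=> [_ xyr] j; exact: (xyr ord0 j).
Qed.

(** An open set is the union of the cubes with rational centre and radius that it contains, and
    there are countably many of these. *)
Lemma Rn_open_measurable A : open A -> measurable A.
Proof.
move=> oA; pose c (z : 'rV[rat]_N * rat) : set (Rn R N) :=
  cube (map_mx ratr z.1) (ratr z.2).
rewrite (_ : A = \bigcup_(z in [set z | c z `<=` A]) c z); last first.
  apply/seteqP; split => [x Ax|x [z /= zA]]; last exact: zA.
  have /nbhs_ballP[e /= e0 eA] := open_nbhs_nbhs (conj oA Ax).
  (* With radius [q < e / 2] and a rational centre within [q] of [x] in each coordinate, the cube
     contains [x] and stays within [e] of it. *)
  have [q /[!in_itv]/= /andP[q0 qe]] : exists q : rat, ratr q \in `]0, (e / 2)[.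
    by apply: rat_in_itvoo; rewrite divr_gt0.
  have near_rat (i : 'I_N) : {t : rat | `|ratr t - x ord0 i| < ratr q :> R}.
    apply/cid; have [|t] := @rat_in_itvoo R (x ord0 i - ratr q) (x ord0 i + ratr q).
      by rewrite ltrD2l gtrN.
    rewrite in_itv/= => tq; exists t; rewrite ltr_distl; exact: tq.
  exists (\row_i sval (near_rat i), q); last first.
    by move=> i /=; rewrite !mxE; exact: (svalP (near_rat i)).
  move=> y /= yq; apply: eA; rewrite -cubeE// => i.
  rewrite (splitr e); have := ltrD (svalP (near_rat i)) (yq i).
  rewrite !mxE distrC => h.
  apply: le_lt_trans (lt_trans h _); last exact: ltrD.
  by rewrite (le_trans _ (ler_normD _ _))// addrA subrK.
rewrite bigcup_mkcond; apply: countable_bigcupT_measurable => [|z].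
  exact: countableP.
by case: ifP => // _; exact: cube_measurable.
Qed.


End Rn_measurability.

(** Induction on the dimension: [bRn_cons] pulls a cube back to an interval of length [2 * r] times
    a cube of one dimension less. In dimension 0 the Dirac mass gives 1, the empty product. *)
Lemma borel_lebesgue_cube (R : realType) (N : nat) (x : Rn R N) (r : R) :
  0 <= r -> borel_lebesgue (cube x r) = ((2 * r) ^+ N)%:E.
Proof.
move=> r0; elim: N x => [|N IH] x.
  by rewrite /= diracE expr0 (_ : _ \in _) // inE => -[].
rewrite /= /pushforward (_ : @bRn_cons _ _ @^-1` _ =
    ball (x ord0 ord0) r `*` cube (\row_j x ord0 (lift ord0 j)) r); last first.
  apply/seteqP; split => -[a y] /=.
    move=> xy; split; first by have := xy ord0; rewrite mxE unlift_none.
    by move=> i; have := xy (lift ord0 i); rewrite !mxE liftK.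
  move=> [xa xy] i; rewrite mxE; case: unliftP => [j ->|->] //.
  by have := xy j; rewrite mxE.
rewrite product_measure1E; last 2 first.
- exact: measurable_ball.
- exact: bRn_cube_measurable.
move: (IH (\row_j x ord0 (lift ord0 j))) => /= ->; rewrite lebesgue_measure_ball//.
by rewrite -EFinM exprS mulr_natl.
Qed.

Lemma lebesgue_cube (R : realType) (N : nat) (x : Rn R N) (r : R) :
  0 <= r -> lebesgue_Rn (cube x r) = ((2 * r) ^+ N)%:E.
Proof.
move=> r0; rewrite -(borel_lebesgue_cube x r0).
rewrite /lebesgue_Rn /completed_measure_extension measurable_mu_extE//.
exact: bRn_cube_measurable.
Qed.


(** * Fractional Sobolev inequality *)

Section difference_quotient.
Context (R : realType) (N : nat).
Implicit Types (x y : Rn R N) (z : Rn R N * Rn R N) (w : Rn R N -> R).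

Lemma dotRn_ge0 x : 0 <= dotRn x x.
Proof. by apply: sumr_ge0 => i _; rewrite -expr2 sqr_ge0. Qed.

Lemma enorm_ge0 x : 0 <= enorm x.
Proof. exact: sqrtr_ge0. Qed.

Lemma enorm_eq0 x : enorm x = 0 -> x = 0.
Proof.
move=> /eqP; rewrite sqrtr_eq0 => x0.
have /psumr_eq0P x_eq0 : forall i, true -> 0 <= x ord0 i * x ord0 i.
  by move=> i _; rewrite -expr2 sqr_ge0.
apply/rowP => i; rewrite mxE; apply/eqP; rewrite -sqrf_eq0 expr2.
by rewrite x_eq0//; apply/eqP; rewrite eq_le x0 dotRn_ge0.
Qed.

Lemma enorm_le_cube x y (r : R) :
  0 <= r -> cube x r y -> enorm (x - y) <= Num.sqrt N%:R * r.
Proof.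
move=> r0 xyr; rewrite -[X in _ * X](ger0_norm r0) -sqrtr_sqr -sqrtrM//.
rewrite ler_wsqrtr// /dotRn mulr_natl -[X in _ *+ X]card_ord -sumr_const.
apply: ler_sum => i _; rewrite -expr2 !mxE -real_normK ?num_real//.
by rewrite ler_sqr ?nnegrE// ltW.
Qed.

Lemma measurable_enormB :
  measurable_fun setT (fun z => enorm (z.1 - z.2) : R).
Proof.
(* The square root is written as a power so that [measurable_powR] applies. *)
rewrite (_ : (fun z => _) = (@powR R ^~ 2^-1) \o
    (fun z => \sum_(i < N) (z.1 ord0 i - z.2 ord0 i) ^+ 2)); last first.
  apply/funext => z /=; rewrite powR12_sqrt; last first.
    by apply: sumr_ge0 => i _; exact: sqr_ge0.
  by congr Num.sqrt; apply: eq_bigr => i _; rewrite !mxE expr2.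
apply: measurableT_comp; first exact: measurable_powR.
apply: measurable_sum => i; apply: measurable_funX; apply: measurable_funB.
  exact: measurableT_comp (measurable_Rn_coord i) measurable_fst.
exact: measurableT_comp (measurable_Rn_coord i) measurable_snd.
Qed.

(** The integrand of the Gagliardo seminorm when [a = N + ps]. On the diagonal its value is 0 for
    nonzero [p]. *)
Definition dquot (p a : R) w z : R :=
  `|w z.1 - w z.2| `^ p / enorm (z.1 - z.2) `^ a.

Lemma dquot_ge0 p a w z : 0 <= dquot p a w z.
Proof. by rewrite divr_ge0// powR_ge0. Qed.

Lemma measurable_fun_diff w : measurable_fun setT w ->
  measurable_fun setT (fun z => w z.1 - w z.2).
Proof.
move=> mw; apply: measurable_funB.
  exact: measurableT_comp mw measurable_fst.
exact: measurableT_comp mw measurable_snd.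
Qed.

Lemma measurable_enormB_powR a :
  measurable_fun setT (fun z => (enorm (z.1 - z.2) `^ a)^-1 : R).
Proof.
under eq_fun do rewrite -powRN.
by apply: (measurableT_comp (measurable_powR (- a))); exact: measurable_enormB.
Qed.

Lemma measurable_dquot p a w : measurable_fun setT w ->
  measurable_fun setT (dquot p a w).
Proof.
move=> mw; apply: measurable_funM; last exact: measurable_enormB_powR.
apply: (measurableT_comp (measurable_powR p)).
by apply: measurableT_comp => //; exact: measurable_fun_diff.
Qed.

End difference_quotient.

(** * Pointwise form of the Sobolev inequality *)

Lemma lee_markov d (T : measurableType d) (R : realType)
    (mu : {measure set T -> \bar R}) (f : T -> R) (q t I : R) :
  measurable_fun setT f -> (forall x, 0 <= f x) -> 0 < q -> 0 < t ->
  (\int[mu]_x (f x `^ q)%:E <= I%:E)%E ->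
  (mu [set x | (t < f x)%R] <= (I / t `^ q)%:E)%E.
Proof.
move=> mf f0 q0 t0 fI.
have mA : measurable [set x | (t < f x)%R].
  rewrite -[X in measurable X]setTI.
  by rewrite -preimage_itvoy; exact: mf.
have tq0 : 0 < t `^ q by exact: powR_gt0.
rewrite EFinM lee_pdivlMr// muleC -integral_cst//.
apply: le_trans fI.
apply: (@le_trans _ _ (\int[mu]_(x in [set x | (t < f x)%R]) (f x `^ q)%:E)%E).
- apply: ge0_le_integral => //=.
  + by move=> x _; rewrite lee_fin powR_ge0.
  + apply/measurable_EFinP; apply: measurable_funTS.
    exact: measurableT_comp (measurable_powR q) mf.
  + move=> x /ltW tf; by rewrite lee_fin; apply: ge0_ler_powR; rewrite ?nnegrE// ltW.
- apply: ge0_subset_integral => //.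
  + apply/measurable_EFinP; exact: measurableT_comp (measurable_powR q) mf.
  + by move=> x _; rewrite lee_fin powR_ge0.
Qed.

(** Passing to logarithms turns an identity between products of real powers into a linear one, which
    [field] can decide. *)
Lemma gt0_expRP (R : realType) (x : R) : 0 < x -> exists y, x = expR y.
Proof. by move=> x0; exists (ln x); rewrite lnK. Qed.

(* [c] is the ratio between the Euclidean and the maximum norm. *)
Definition sobolev_cst (R : realType) (n p q sigma c : R) : R :=
  2 `^ (p + 1) * (c / 2) `^ (n + sigma) * 2 `^ ((1 + q) * sigma / n).

Lemma sobolev_cst_gt0 (R : realType) (n p q sigma c : R) :
  0 < c -> 0 < sobolev_cst n p q sigma c.
Proof. by move=> c0; rewrite !mulr_gt0// powR_gt0// divr_gt0. Qed.

(** Both sides are monomials in [a], [I], [c] and 2. The powers of [I] cancel on the right because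
    [V] enters with total exponent [- sigma / n], and the powers of [a] agree exactly by
    [p + q * sigma / n = q]. *)
Lemma sobolev_scaling (R : realType) (n p q sigma c a I V r : R) :
  0 < n -> 0 < c -> 0 < a -> 0 < I -> p + q * sigma / n = q ->
  V = I / (a / 2) `^ q -> r = (2 * V) `^ n^-1 / 2 ->
  a `^ q = sobolev_cst n p q sigma c * I `^ (sigma / n) *
    ((a / 2) `^ p / (c * r) `^ (n + sigma) * V).
Proof.
move=> n0 c0 a0 I0 pq -> ->; rewrite /sobolev_cst.
have [l2 l2E] := @gt0_expRP R 2 ltac:(by []).
have [la ->] := gt0_expRP a0; have [lc ->] := gt0_expRP c0.
have [lI ->] := gt0_expRP I0; rewrite l2E.
rewrite !(=^~ expRM, =^~ expRN, =^~ expRD); congr expR.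
have -> : p = q - q * sigma / n by rewrite -{1}pq addrK.
by field; rewrite gt_eqF.
Qed.

(* If [a = w x > 0] and [I] bounds the integral of [w `^ q], then [w <= a / 2]
   on at least half of the cube of volume [2 I / (a / 2) `^ q] centred at [x];
   this bounds the difference quotients at [x] from below. *)
Lemma pointwise_sobolev (R : realType) (N : nat) (p q sigma I : R)
    (w : Rn R N -> R) (x : Rn R N) :
  (0 < N)%N -> 0 < p -> 0 < sigma -> 0 < q -> p + q * sigma / N%:R = q ->
  measurable_fun setT w -> (forall y, 0 <= w y) -> 0 < I ->
  (\int[lebesgue_Rn]_y (w y `^ q)%:E <= I%:E)%E ->
  ((w x `^ q)%:E <=
    (sobolev_cst N%:R p q sigma (Num.sqrt N%:R) * I `^ (sigma / N%:R))%:E *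
    \int[lebesgue_Rn]_y (dquot p (N%:R + sigma) w (x, y))%:E)%E.
Proof.
move=> N0 p0 sigma0 q0 pq mw w0 I0 wI.
set S := (sobolev_cst _ _ _ _ _ * _).
have n0 : 0 < N%:R :> R by rewrite ltr0n.
have c0 : 0 < Num.sqrt N%:R :> R by rewrite sqrtr_gt0.
have S0 : 0 < S by rewrite mulr_gt0 ?sobolev_cst_gt0 ?powR_gt0.
have [wx0|wx_gt0] := leP (w x) 0.
  rewrite (_ : w x = 0); last by apply/eqP; rewrite eq_le wx0 w0.
  rewrite powR0 ?gt_eqF// mule_ge0// ?lee_fin ?(ltW S0)//.
  by apply: integral_ge0 => y _; rewrite lee_fin dquot_ge0.
(* [V] is Markov's bound for the measure of [{w > w x / 2}], and [r] is the radius for which the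
   cube has volume [2 * V]. Hence the rest [D] of the cube has measure at least [V]. *)
pose V := I / (w x / 2) `^ q; pose r := (2 * V) `^ N%:R^-1 / 2.
have V0 : 0 < V by rewrite divr_gt0// powR_gt0// divr_gt0.
have r0 : 0 < r by rewrite divr_gt0// powR_gt0// mulr_gt0.
pose D := cube x r `&` ~` [set y | (w x / 2 < w y)%R].
have mL : measurable [set y | (w x / 2 < w y)%R].
  rewrite -[X in measurable X]setTI -preimage_itvoy; exact: mw.
have mD : measurable D.
  by apply: measurableI; [exact: cube_measurable|exact: measurableC].
have VD : (V%:E <= lebesgue_Rn D)%E.
  have cubeV : lebesgue_Rn (cube x r) = (2 * V)%:E.
    rewrite lebesgue_cube ?(ltW r0)// /r mulrCA divff// mulr1.
    rewrite -powR_mulrn ?powR_ge0// -powRrM mulVf ?gt_eqF// powRr1//.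
    by rewrite mulr_ge0 ?ltW.
  have cubeD : (lebesgue_Rn (cube x r) <=
      lebesgue_Rn D + lebesgue_Rn [set y | (w x / 2 < w y)%R])%E.
    apply: le_trans (measureU2 _ mD mL); apply: le_measure; rewrite ?inE.
    - exact: cube_measurable.
    - exact: measurableU.
    - by move=> y xy; have [?|?] := pselect ((w x / 2 < w y)%R); [right|left].
  have markov : (lebesgue_Rn [set y | (w x / 2 < w y)%R] <= V%:E)%E.
    by apply: lee_markov => //; exact: divr_gt0.
  move: cubeD markov; rewrite cubeV.
  have := measure_ge0 lebesgue_Rn [set y | (w x / 2 < w y)%R].
  have := measure_ge0 lebesgue_Rn D.
  case: (lebesgue_Rn D) => [d| |] //; last by rewrite leey.
  case: (lebesgue_Rn _) => [e| |] //; rewrite -?EFinD ?lee_fin; lra.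
rewrite (sobolev_scaling n0 c0 wx_gt0 I0 pq (erefl V) (erefl r)) EFinM.
rewrite lee_pmul2l//.
set b := (_ / _); rewrite EFinM; apply: (@le_trans _ _ (b%:E * lebesgue_Rn D)%E).
  by rewrite lee_pmul2l// lte_fin divr_gt0// powR_gt0// ?divr_gt0// mulr_gt0.
rewrite -integral_cst//.
apply: (@le_trans _ _
  (\int[lebesgue_Rn]_(y in D) (dquot p (N%:R + sigma) w (x, y))%:E)%E).
- apply: ge0_le_integral => //.
  + by move=> y _; rewrite lee_fin divr_ge0 ?powR_ge0.
  + apply/measurable_EFinP; apply: measurable_funTS.
    exact: measurableT_comp (measurable_dquot _ _ mw) (measurable_pair1 x).
  + move=> y [xy /negP]; rewrite -leNgt => wy.
    rewrite lee_fin /dquot /=.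
    have wxy : w x / 2 <= `|w x - w y|.
      apply: le_trans (ler_norm _).
      by rewrite lerBrDr (le_trans (lerD (lexx _) wy))// -splitr.
    have exy : enorm (x - y) <= Num.sqrt N%:R * r.
      exact: enorm_le_cube (ltW r0) xy.
    (* At [y = x] the quotient has the default value 0 and the lower bound would fail. This case is
       excluded, since [w x - w y] is at least [w x / 2 > 0] on [D]. *)
    have := enorm_ge0 (x - y); rewrite le_eqVlt => /predU1P[e0|e0].
      move: wxy; rewrite (_ : w x - w y = 0).
        by rewrite normr0 leNgt divr_gt0.
      apply/eqP; rewrite subr_eq0; apply/eqP; congr w.
      by apply/eqP; rewrite -subr_eq0; apply/eqP/enorm_eq0; rewrite -e0.
    apply: ler_pM; rewrite ?invr_ge0 ?powR_ge0//.
      by apply: ge0_ler_powR;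
        rewrite ?nnegrE ?normr_ge0 ?divr_ge0 ?(ltW p0) ?(ltW wx_gt0).
    have cr0 := mulr_gt0 c0 r0.
    rewrite lef_pV2 ?posrE ?powR_gt0//.
    apply: ge0_ler_powR => //; rewrite ?nnegrE ?enorm_ge0//.
      exact: addr_ge0 (ltW n0) (ltW sigma0).
    exact: ltW.
- apply: ge0_subset_integral => //.
  + apply/measurable_EFinP.
    exact: measurableT_comp (measurable_dquot _ _ mw) (measurable_pair1 x).
  + by move=> y _; rewrite lee_fin dquot_ge0.
Qed.

Lemma ler_dist_min (R : realDomainType) (a b c : R) :
  `|Num.min a c - Num.min b c| <= `|a - b|.
Proof.
have ab := ler_norm (a - b); have := ler_norm (b - a); rewrite distrC => ba.
by rewrite ler_norml; case: (leP a c); case: (leP b c); lra.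
Qed.

(** * Integrated Sobolev inequality *)

Section sobolev.
Context (R : realType) (N : nat) (Omega : set (Rn R N)) (p q sigma : R).
Hypotheses (N_gt0 : (0 < N)%N) (mOmega : measurable Omega) (p_gt0 : 0 < p)
  (sigma_gt0 : 0 < sigma) (q_gt0 : 0 < q) (pqE : p + q * sigma / N%:R = q).
Implicit Types (x y : Rn R N) (z : Rn R N * Rn R N) (w v : Rn R N -> R).

Let S := sobolev_cst N%:R p q sigma (Num.sqrt N%:R).

Lemma measurable_Qset : measurable (Qset Omega).
Proof. by apply: measurableC; apply: measurableX; exact: measurableC. Qed.

(** By Tonelli the left-hand side is the integral over [Omega] times the whole space, a subset of
    [Qset Omega]. *)
Lemma integral_section_le w : measurable_fun setT w ->
  (\int[lebesgue_Rn]_(x in Omega)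
      \int[lebesgue_Rn]_y (dquot p (N%:R + sigma) w (x, y))%:E <=
   \int[@lebesgue_Rn2 R N]_(z in Qset Omega) (dquot p (N%:R + sigma) w z)%:E)%E.
Proof.
move=> mw; have mE : measurable (Omega `*` [set: Rn R N]).
  by apply: measurableX.
have mdq : measurable_fun setT (EFin \o dquot p (N%:R + sigma) w).
  by apply/measurable_EFinP; exact: measurable_dquot.
apply: (@le_trans _ _ (\int[@lebesgue_Rn2 R N]_(z in Omega `*` setT)
    (dquot p (N%:R + sigma) w z)%:E)%E); last first.
  apply: ge0_subset_integral => //; first exact: measurable_Qset.
  - exact: measurable_funTS.
  - by move=> z _; rewrite lee_fin dquot_ge0.
  - by move=> [x y] [/= Ox _] [].
rewrite le_eqVlt; apply/orP; left; apply/eqP.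
rewrite [RHS]integral_mkcond [LHS]integral_mkcond fubini_tonelli1/=; last 2 first.
- by apply/(measurable_restrictT _ mE)/measurable_funTS.
- by move=> z; apply: erestrict_ge0 => ? _; rewrite lee_fin dquot_ge0.
apply: eq_integral => x _; rewrite /fubini_F patchE; case: ifPn => xO.
  apply: eq_integral => y _; rewrite patchE ifT// inE; split => //.
  by rewrite inE in xO.
rewrite integral0_eq// => y _; rewrite patchE ifF//.
apply/negbTE; apply: contra xO; by rewrite !inE => -[].
Qed.

(** With [I] the integral of [w ^ q], integrating the pointwise bound over [Omega], off which [w]
    vanishes almost everywhere, gives [I <= S I^(sigma/N) e]. Finiteness of [I] is what allows
    division by its power. *)
Lemma sobolev_finite w (e : R) : measurable_fun setT w ->
  (forall x, 0 <= w x) ->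
  {ae lebesgue_Rn, forall x, ~ Omega x -> w x = 0} ->
  (\int[lebesgue_Rn]_x (w x `^ q)%:E < +oo)%E ->
  (\int[@lebesgue_Rn2 R N]_(z in Qset Omega)
     (dquot p (N%:R + sigma) w z)%:E <= e%:E)%E ->
  (\int[lebesgue_Rn]_x (w x `^ q)%:E <= ((S * e) `^ (q / p))%:E)%E.
Proof.
move=> mw w0 wO; set I0 := (\int[_]_x _)%E => Ioo we.
have n0 : 0 < N%:R :> R by rewrite ltr0n.
have I0_ge0 : (0 <= I0)%E.
  by apply: integral_ge0 => x _; rewrite lee_fin powR_ge0.
have S0 : 0 < S by rewrite sobolev_cst_gt0// sqrtr_gt0.
have mwq : measurable_fun setT (fun x => (w x `^ q)%:E).
  by apply/measurable_EFinP; exact: measurableT_comp (measurable_powR q) mw.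
have [I IE] : exists I, I0 = I%:E.
  by exists (fine I0); rewrite fineK// ge0_fin_numE.
rewrite IE lee_fin; move: I0_ge0; rewrite IE lee_fin le_eqVlt.
move=> /predU1P[<-|I_gt0]; first exact: powR_ge0.
have wI : (I0 <= I%:E)%E by rewrite IE.
pose g x := (\int[lebesgue_Rn]_y (dquot p (N%:R + sigma) w (x, y))%:E)%E.
have g0 x : (0 <= g x)%E.
  by apply: integral_ge0 => y _; rewrite lee_fin dquot_ge0.
have mg : measurable_fun setT g.
  apply: (@measurable_fun_fubini_tonelli_F _ _ _ _ _ lebesgue_Rn
    (EFin \o dquot p (N%:R + sigma) w)).
  - by apply/measurable_EFinP; exact: measurable_dquot.
  - by move=> z; rewrite lee_fin dquot_ge0.
have IO : I0 = (\int[lebesgue_Rn]_(x in Omega) (w x `^ q)%:E)%E.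
  rewrite [RHS]integral_mkcond; apply: ge0_ae_eq_integral => //.
  - exact/(measurable_restrictT _ mOmega)/measurable_funTS.
  - by move=> x _; rewrite lee_fin powR_ge0.
  - by move=> x _; apply: erestrict_ge0 => ? _; rewrite lee_fin powR_ge0.
  - move: wO; apply: filterS => x wx _; rewrite patchE; case: ifPn => // xO.
    by rewrite wx ?powR0 ?gt_eqF// -notin_setE.
have : (I0 <= (S * I `^ (sigma / N%:R))%:E * e%:E)%E.
  have c0 : 0 < S * I `^ (sigma / N%:R) by rewrite mulr_gt0// powR_gt0.
  apply: (@le_trans _ _ ((S * I `^ (sigma / N%:R))%:E *
      \int[lebesgue_Rn]_(x in Omega) g x)%E).
    rewrite -ge0_integralZl//; last 2 first.
    - exact: measurable_funTS.
    - exact: ltW.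
    rewrite IO; apply: (@ge0_le_integral _ _ _ _ _ mOmega
      (fun x => (w x `^ q)%:E)
      (fun x => (S * I `^ (sigma / N%:R))%:E * g x)%E).
    - by move=> x _; rewrite lee_fin powR_ge0.
    - exact: measurable_funTS.
    - by apply: measurable_funeM; exact: measurable_funTS.
    - by move=> x _; exact: pointwise_sobolev.
  rewrite lee_pmul2l//.
  exact: le_trans (integral_section_le mw) we.
rewrite IE -EFinM lee_fin => Ie.
(* The exponent left on [I] after the absorption. *)
have pq : 1 - sigma / N%:R = p / q.
  by rewrite -[in RHS](addrK (q * sigma / N%:R) p) pqE; field; rewrite !gt_eqF.
have Ipq : I `^ (p / q) <= S * e.
  rewrite -pq powRB; last by rewrite (gt_eqF I_gt0) implybT.
  rewrite powRr1 ?(ltW I_gt0)//.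
  by rewrite ler_pdivrMr ?powR_gt0// mulrAC.
have -> : I = (I `^ (p / q)) `^ (q / p).
  have pqK : p / q * (q / p) = 1 by field; rewrite !gt_eqF.
  by rewrite -powRrM pqK powRr1// ltW.
apply: ge0_ler_powR => //; rewrite ?nnegrE ?powR_ge0//.
  by rewrite divr_ge0 ?ltW.
exact: le_trans (powR_ge0 _ _) Ipq.
Qed.

Lemma dquot_le a w v z : `|v z.1 - v z.2| <= `|w z.1 - w z.2| ->
  dquot p a v z <= dquot p a w z.
Proof.
move=> vw; rewrite ler_wpM2r ?invr_ge0 ?powR_ge0//.
by apply: ge0_ler_powR; rewrite ?nnegrE ?normr_ge0// ltW.
Qed.

(** The truncations [min(w, j)] have finite [q]-integral, as [min(w, j)^q <= j^(q - p) w^p], and no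
    larger difference quotients. The bound for them is uniform in [j] and passes to [w] by monotone
    convergence. *)
Lemma sobolev w (e : R) : measurable_fun setT w ->
  (forall x, 0 <= w x) ->
  {ae lebesgue_Rn, forall x, ~ Omega x -> w x = 0} ->
  (\int[lebesgue_Rn]_x (w x `^ p)%:E < +oo)%E ->
  (\int[@lebesgue_Rn2 R N]_(z in Qset Omega)
     (dquot p (N%:R + sigma) w z)%:E <= e%:E)%E ->
  (\int[lebesgue_Rn]_x (w x `^ q)%:E <= ((S * e) `^ (q / p))%:E)%E.
Proof.
move=> mw w0 wO wp we.
have n0 : 0 < N%:R :> R by rewrite ltr0n.
have pq : p <= q by rewrite -pqE lerDl divr_ge0// mulr_ge0// ltW.
pose v j x := Num.min (w x) j%:R.
have mv j : measurable_fun setT (v j) by exact: measurable_minr.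
have v0 j x : 0 <= v j x by rewrite le_min w0 ler0n.
have mvq j r : measurable_fun setT (fun x => (v j x `^ r)%:E).
  by apply/measurable_EFinP; exact: measurableT_comp (measurable_powR r) (mv j).
have mwp : measurable_fun setT (fun x => (w x `^ p)%:E).
  by apply/measurable_EFinP; exact: measurableT_comp (measurable_powR p) mw.
have vq_lty j : (\int[lebesgue_Rn]_x (v j x `^ q)%:E < +oo)%E.
  apply: (@le_lt_trans _ _ ((j%:R `^ (q - p))%:E *
      \int[lebesgue_Rn]_x (w x `^ p)%:E)%E); last first.
    by rewrite lte_mul_pinfty ?lee_fin ?powR_ge0.
  rewrite -ge0_integralZl; [|exact: measurableT|exact: mwp| |]; last 2 first.
  - by move=> x _; rewrite lee_fin powR_ge0.
  - by rewrite lee_fin powR_ge0.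
  apply: ge0_le_integral; [exact: measurableT| |exact: mvq| |].
  - by move=> x _; rewrite lee_fin powR_ge0.
  - exact: measurable_funeM.
  - move=> x _; have -> : v j x `^ q = v j x `^ (q - p) * v j x `^ p.
      by rewrite -powRD subrK// gt_eqF.
    rewrite lee_fin.
    apply: ler_pM; rewrite ?powR_ge0//; apply: ge0_ler_powR;
      by rewrite ?nnegrE ?subr_ge0 ?ler0n ?ge_min ?lexx ?orbT ?(ltW p_gt0).
have vq j : (\int[lebesgue_Rn]_x (v j x `^ q)%:E <= ((S * e) `^ (q / p))%:E)%E.
  apply: (@sobolev_finite (v j) e (mv j) (v0 j) _ (vq_lty j)).
    by move: wO; apply: filterS => x wx /wx; rewrite /v => ->; rewrite min_l.
  apply: le_trans we; apply: ge0_le_integral.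
  - exact: measurable_Qset.
  - by move=> z _; rewrite lee_fin dquot_ge0.
  - by apply/measurable_EFinP/measurable_funTS; exact: measurable_dquot.
  - by apply/measurable_EFinP/measurable_funTS; exact: measurable_dquot.
  - by move=> z _; rewrite lee_fin; apply: dquot_le; exact: ler_dist_min.
have vcvg : (fun j => \int[lebesgue_Rn]_x (v j x `^ q)%:E)%E @ \oo -->
    (\int[lebesgue_Rn]_x (w x `^ q)%:E)%E.
  have -> : (\int[lebesgue_Rn]_x (w x `^ q)%:E =
      \int[lebesgue_Rn]_x limn (fun j => (v j x `^ q)%:E))%E.
    apply: eq_integral => x _; apply/esym/cvg_lim => //.
    (* At a fixed [x] the sequence is constant as soon as [j] exceeds [w x]. *)
    apply: cvg_near_cst; near=> j.
    rewrite /v min_l//; apply: ltW; apply: lt_le_trans (_ : (Num.truncn (w x)).+1%:R <= _).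
      by rewrite truncnS_gt.
    rewrite ler_nat; near: j; exact: nbhs_infty_ge.
  apply: cvg_monotone_convergence; [exact: measurableT|by move=> j; exact: mvq| |].
  - by move=> j x _; rewrite lee_fin powR_ge0.
  - move=> x _ i j ij; rewrite lee_fin; apply: ge0_ler_powR;
      rewrite ?nnegrE ?v0 ?(ltW q_gt0)//.
    by rewrite /v le_min !ge_min lexx/= ler_nat ij orbT.
rewrite -(cvg_lim _ vcvg)//; apply: lime_le; first exact: cvgP vcvg.
exact: nearW.
Unshelve. all: by end_near. Qed.

End sobolev.

(** * Truncations as test functions *)

Lemma Lfun_onP d (T : measurableType d) (R : realType)
    (mu : {measure set T -> \bar R}) (q : R) (D : set T) (f : T -> R) :
  0 < q -> measurable D -> measurable_fun setT f ->
  Lfun_on mu q%:E D f <-> (\int[mu]_(x in D) (`|f x| `^ q)%:E < +oo)%E.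
Proof.
move=> q0 mD mf.
have -> : (\int[mu]_(x in D) (`|f x| `^ q)%:E =
    \int[mu]_x (`|(EFin \o (f \_ D)) x| `^ q))%E.
  rewrite integral_mkcond; apply: eq_integral => x _; rewrite /= !patchE.
  by case: ifPn => // _; rewrite normr0 powR0// gt_eqF.
rewrite -powR_Lnorm ?gt_eqF//; split=> [/andP[_]|fq].
  by rewrite inE; exact: poweR_lty.
apply/andP; split; rewrite inE/=.
  by apply/(measurable_restrictT _ mD)/measurable_funTS.
by apply: lty_poweRy fq; rewrite gt_eqF.
Qed.

(** The truncation [(u - k)_+], used as test function at level [k]. *)
Definition excess (T : Type) (R : realDomainType) (u : T -> R) (k : R) (x : T) : R :=
  Num.max (u x - k) 0.

Section excess.
Context (R : realType).
Implicit Types (a b k p : R).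

Lemma excess_ge0 T (u : T -> R) k x : 0 <= excess u k x.
Proof. by rewrite le_max lexx orbT. Qed.

Lemma excess_le T (u : T -> R) h k x : h <= k -> excess u k x <= excess u h x.
Proof.
by move=> hk; rewrite /excess; case: (leP (u x - k)); case: (leP (u x - h)); lra.
Qed.

Lemma excess_le_norm T (u : T -> R) k x : 0 <= k -> `|excess u k x| <= `|u x|.
Proof.
move=> k0; rewrite ger0_norm ?excess_ge0// /excess.
by have := ler_norm (u x); have := normr_ge0 (u x); case: (leP (u x - k) 0); lra.
Qed.

Lemma excess_dist T (u : T -> R) k x y :
  `|excess u k x - excess u k y| <= `|u x - u y|.
Proof.
have ab := ler_norm (u x - u y); have := ler_norm (u y - u x); rewrite distrC => ba.
by rewrite ler_norml /excess; case: (leP (u x - k)); case: (leP (u y - k)); lra.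
Qed.

(** Truncation is nondecreasing in the value of [u], so the two differences never have opposite
    signs. *)
Lemma excess_mul T (u : T -> R) k x y :
  (u x - u y) * (excess u k x - excess u k y) =
  `|u x - u y| * `|excess u k x - excess u k y|.
Proof.
rewrite -normrM ger0_norm// /excess.
have [uxy|/ltW uxy] := leP (u x) (u y).
  rewrite mulr_le0// ?subr_le0//.
  by case: (leP (u x - k)); case: (leP (u y - k)); lra.
rewrite mulr_ge0// ?subr_ge0//.
by case: (leP (u x - k)); case: (leP (u y - k)); lra.
Qed.

Lemma measurable_excess d (T : measurableType d) (u : T -> R) k :
  measurable_fun setT u -> measurable_fun setT (excess u k).
Proof.
move=> mu; apply: measurable_maxr => //.
exact: measurable_funB.
Qed.

(** With [D = |u x - u y|] and [e <= D] the difference of the truncations, the middle term is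
    [e D^(p-1)]. The lower bound is the coercivity of the pairing, the upper one its
    integrability. *)
Lemma plap_pointwise T (u : T -> R) k p x y : 1 < p ->
  `|excess u k x - excess u k y| `^ p <=
    `|u x - u y| `^ (p - 2) * (u x - u y) * (excess u k x - excess u k y)
    <= `|u x - u y| `^ p.
Proof.
move=> p1; rewrite -mulrA excess_mul; have := excess_dist u k x y.
move: (`|u x - u y|) (normr_ge0 (u x - u y)) => D.
move: (`|_|) (normr_ge0 (excess u k x - excess u k y)) => e e0 D0 eD.
have p0 : 0 < p by lra.
have p10 : 0 <= p - 1 by lra.
(* The case [D = 0] is separate: the exponent [p - 2] may be negative or zero, and powers are merged
   only for a nonzero base. *)
move: D0; rewrite le_eqVlt => /predU1P[D0|D0].
  have -> : e = 0 by apply/eqP; rewrite eq_le e0 D0 eD.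
  by rewrite -D0 powR0 ?gt_eqF// !mulr0 lexx.
have -> : D `^ (p - 2) * (D * e) = e * D `^ (p - 1).
  have -> : D `^ (p - 1) = D `^ (p - 2) * D.
    rewrite -[X in _ * X](powRr1 (ltW D0)) -powRD ?(gt_eqF D0) ?implybT//.
    by congr powR; ring.
  by ring.
rewrite -(mulr_powRB1 e0 p0) -(mulr_powRB1 (ltW D0) p0); apply/andP; split.
  rewrite ler_wpM2l//; apply: ge0_ler_powR; rewrite ?nnegrE//; exact: ltW.
by rewrite ler_wpM2r// powR_ge0.
Qed.

End excess.

Section X0.
Context (R : realType) (N : nat) (Omega : set (Rn R N)) (s p : R).
Hypotheses (mOmega : measurable Omega) (p_gt1 : 1 < p).
Implicit Types (u : Rn R N -> R).
Local Notation dq := (dquot p (N%:R + p * s)).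

Let p_gt0 : 0 < p. Proof. by rewrite (lt_trans _ p_gt1). Qed.

Lemma X0P u : X0 Omega s p u <->
  [/\ measurable_fun setT u,
      (\int[lebesgue_Rn]_(x in Omega) (`|u x| `^ p)%:E < +oo)%E,
      (\int[@lebesgue_Rn2 R N]_(z in Qset Omega) (dq u z)%:E < +oo)%E &
      {ae lebesgue_Rn, forall x, ~ Omega x -> u x = 0}].
Proof.
pose f z : R :=
  `|u z.1 - u z.2| / enorm (z.1 - z.2) `^ ((N%:R + p * s) / p).
have mQ : measurable (Qset Omega) by exact: measurable_Qset.
have -> : (\int[@lebesgue_Rn2 R N]_(z in Qset Omega) (dq u z)%:E =
    \int[@lebesgue_Rn2 R N]_(z in Qset Omega) (`|f z| `^ p)%:E)%E.
  apply: eq_integral => z _; congr EFin.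
  rewrite ger0_norm ?divr_ge0 ?powR_ge0// powRM ?invr_ge0 ?powR_ge0//.
  by rewrite -powRN -powRrM mulNr divfK ?gt_eqF// powRN.
have mf : measurable_fun setT u -> measurable_fun setT f.
  move=> mu; apply: measurable_funM; last exact: measurable_enormB_powR.
  by apply: measurableT_comp => //; exact: measurable_fun_diff.
by split=> -[mu h1 h2 h3]; split => //;
  (apply/Lfun_onP => //; exact: mf) || exact/Lfun_onP.
Qed.

Lemma excess_ae0 u k : 0 <= k ->
  {ae lebesgue_Rn, forall x, ~ Omega x -> u x = 0} ->
  {ae lebesgue_Rn, forall x, ~ Omega x -> excess u k x = 0}.
Proof.
move=> k0; apply: filterS => x ux /ux u0.
by rewrite /excess u0 sub0r max_r// oppr_le0.
Qed.

Lemma integral_dquot_excess u k : measurable_fun setT u ->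
  (\int[@lebesgue_Rn2 R N]_(z in Qset Omega) (dq (excess u k) z)%:E <=
   \int[@lebesgue_Rn2 R N]_(z in Qset Omega) (dq u z)%:E)%E.
Proof.
move=> mu; have mw := measurable_excess k mu; apply: ge0_le_integral.
- exact: measurable_Qset.
- by move=> z _; rewrite lee_fin dquot_ge0.
- by apply/measurable_EFinP/measurable_funTS; exact: measurable_dquot.
- by apply/measurable_EFinP/measurable_funTS; exact: measurable_dquot.
- by move=> z _; rewrite lee_fin dquot_le// excess_dist.
Qed.

(** Makes [(u - k)_+] admissible in the weak formulation: it is dominated by [u] both in absolute
    value and in its differences, and [k >= 0] keeps it zero where [u] is zero. *)
Lemma X0_excess u k : 0 <= k -> X0 Omega s p u -> X0 Omega s p (excess u k).
Proof.
move=> k0 /X0P[mu up uq u0]; apply/X0P; split.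
- exact: measurable_excess.
- apply: le_lt_trans up; apply: ge0_le_integral; [exact: mOmega| | | |].
  + by move=> x _; rewrite lee_fin powR_ge0.
  + apply/measurable_EFinP/measurable_funTS.
    apply: (measurableT_comp (measurable_powR p)).
    by apply: measurableT_comp => //; exact: measurable_excess.
  + apply/measurable_EFinP/measurable_funTS.
    apply: (measurableT_comp (measurable_powR p)).
    exact: measurableT_comp.
  + move=> x _; rewrite lee_fin; apply: ge0_ler_powR;
      by rewrite ?nnegrE ?normr_ge0 ?(ltW p_gt0)// excess_le_norm.
- exact: le_lt_trans (integral_dquot_excess k mu) uq.
- exact: excess_ae0.
Qed.

Lemma X0_integral_lty u : X0 Omega s p u ->
  (\int[lebesgue_Rn]_x (`|u x| `^ p)%:E < +oo)%E.
Proof.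
move=> /X0P[mu up _ u0]; apply: le_lt_trans up.
rewrite [leRHS]integral_mkcond; rewrite le_eqVlt; apply/orP; left; apply/eqP.
have mup : measurable_fun setT (fun x => (`|u x| `^ p)%:E).
  apply/measurable_EFinP; apply: (measurableT_comp (measurable_powR p)).
  exact: measurableT_comp.
apply: ge0_ae_eq_integral; [exact: measurableT|exact: mup| | | |].
- exact/(measurable_restrictT _ mOmega)/measurable_funTS.
- by move=> x _; rewrite lee_fin powR_ge0.
- by move=> x _; apply: erestrict_ge0 => ? _; rewrite lee_fin powR_ge0.
- move: u0; apply: filterS => x ux _; rewrite patchE; case: ifPn => // xO.
  by rewrite ux ?normr0 ?powR0 ?gt_eqF// -notin_setE.
Qed.

End X0.

(** Finiteness for the larger function matters: real-valued integrals send an infinite value to 0,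
    which would break monotonicity. *)
Lemma ge0_le_Rintegral d (T : measurableType d) (R : realType)
    (mu : {measure set T -> \bar R}) (D : set T) (f g : T -> R) :
  measurable D -> measurable_fun D f -> measurable_fun D g ->
  (forall x, D x -> 0 <= f x <= g x) ->
  (\int[mu]_(x in D) (g x)%:E < +oo)%E ->
  \int[mu]_(x in D) f x <= \int[mu]_(x in D) g x.
Proof.
move=> mD mf mg fg goo; have fg' : (\int[mu]_(x in D) (f x)%:E <=
    \int[mu]_(x in D) (g x)%:E)%E.
  apply: ge0_le_integral; [exact: mD| | | |].
  - by move=> x /fg /andP[]; rewrite lee_fin.
  - exact/measurable_EFinP.
  - exact/measurable_EFinP.
  - by move=> x /fg /andP[]; rewrite lee_fin.
rewrite /Rintegral; apply: fine_le => //.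
- rewrite ge0_fin_numE; first exact: le_lt_trans fg' goo.
  by apply: integral_ge0 => x /fg /andP[]; rewrite lee_fin.
- rewrite ge0_fin_numE//; apply: integral_ge0 => x /fg /andP[f0 fgx].
  by rewrite lee_fin (le_trans f0).
Qed.

Section excess_sources.
Context (R : realType) (T : Type) (u : T -> R).
Implicit Types (a b c h k q gamma lambda : R) (x : T).

Lemma excess_gt0 k x : excess u k x != 0 -> k < u x.
Proof.
by rewrite /excess; case: (leP (u x - k) 0); rewrite ?eqxx// subr_gt0.
Qed.

(** Where the excess is nonzero, [u > k >= 0], so the denominator is [u ^ gamma]. Elsewhere both
    sides are 0. *)
Lemma singular_source_excess lambda gamma k x : 0 <= k ->
  lambda / (`|u x| `^ (gamma - 1) * u x) * excess u k x =
  lambda * (`|u x| `^ (- gamma) * excess u k x).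
Proof.
move=> k0; have [->|/excess_gt0 ku] := eqVneq (excess u k x) 0.
  by rewrite !mulr0.
have u0 := le_lt_trans k0 ku; rewrite (gtr0_norm u0) mulrA powRN.
rewrite -[X in _ / (_ * X)](powRr1 (ltW u0)) -powRD ?subrK//.
by rewrite (gt_eqF u0) implybT.
Qed.

Lemma critical_source_excess q k x : 0 <= k ->
  `|u x| `^ (q - 2) * u x * excess u k x = `|u x| `^ (q - 1) * excess u k x.
Proof.
move=> k0; have [->|/excess_gt0 ku] := eqVneq (excess u k x) 0.
  by rewrite !mulr0.
have u0 := le_lt_trans k0 ku; rewrite (gtr0_norm u0).
rewrite -[X in _ * X * _](powRr1 (ltW u0)) -powRD ?(gt_eqF u0) ?implybT//.
by congr (powR _ _ * _); ring.
Qed.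

(* On [k < u] one has [u <= k / (k - h) * (u - h)]. *)
Lemma excess_source_le b q h k x : b <= q - 1 -> 1 <= q -> 1 <= h < k ->
  0 <= `|u x| `^ b * excess u k x <= (k / (k - h)) `^ q * excess u h x `^ q.
Proof.
move=> bq q1 /andP[h1 hk]; rewrite mulr_ge0 ?powR_ge0 ?excess_ge0//=.
have [->|/excess_gt0 ku] := eqVneq (excess u k x) 0.
  by rewrite mulr0 mulr_ge0// powR_ge0.
have u0 : 0 < u x by lra.
have kh : 0 < k - h by lra.
rewrite (gtr0_norm u0) -powRM ?excess_ge0 ?divr_ge0 ?(ltW kh)//; last by lra.
(* Here [u x > k > 1], so [b <= q - 1] gives [u^b <= u^(q-1)], and the excess is at most [u]. *)
apply: (@le_trans _ _ (u x `^ q)).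
  rewrite -(mulr_powRB1 (ltW u0) (lt_le_trans ltr01 q1)) mulrC.
  apply: ler_pM; rewrite ?excess_ge0 ?powR_ge0//.
    rewrite /excess max_l; lra.
  by apply: ler_powR => //; lra.
have c0 : 0 <= k / (k - h) by rewrite divr_ge0 ?(ltW kh)//; lra.
apply: ge0_ler_powR; rewrite ?nnegrE;
  [by lra|exact: ltW|exact: mulr_ge0 c0 (excess_ge0 _ _ _)|].
rewrite /excess max_l; last by lra.
rewrite mulrAC ler_pdivlMr//; nra.
Qed.

End excess_sources.

(** * Caccioppoli inequality for the truncations *)

Section caccioppoli.
Context (R : realType) (N : nat) (Omega : set (Rn R N)).
Context (s p q gamma lambda m : R) (u : Rn R N -> R).
Local Notation dq := (dquot p (N%:R + p * s)).
Hypotheses (mOmega : measurable Omega) (p_gt1 : 1 < p) (q_ge1 : 1 <= q)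
  (gamma_ge0 : 0 <= gamma) (lambda_ge0 : 0 <= lambda) (m_ge0 : 0 <= m)
  (uX0 : X0 Omega s p u).

Lemma plap_pairing_excess k :
  \int[@lebesgue_Rn2 R N]_(z in Qset Omega) dq (excess u k) z <=
  plap_pairing Omega s p u (excess u k).
Proof.
have /(X0P s mOmega p_gt1)[mu _ uoo _] := uX0.
have mQ := measurable_Qset mOmega; have mw := measurable_excess k mu.
have pw z := plap_pointwise u k z.1 z.2 p_gt1.
have mpair : measurable_fun setT (fun z : Rn R N * Rn R N =>
    `|u z.1 - u z.2| `^ (p - 2) * (u z.1 - u z.2) *
    (excess u k z.1 - excess u k z.2) / enorm (z.1 - z.2) `^ (N%:R + p * s)).
  apply: measurable_funM; last exact: measurable_enormB_powR.
  apply: measurable_funM; last exact: measurable_fun_diff.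
  apply: measurable_funM; last exact: measurable_fun_diff.
  apply: (measurableT_comp (measurable_powR (p - 2))).
  by apply: measurableT_comp => //; exact: measurable_fun_diff.
apply: ge0_le_Rintegral; [exact: mQ| | | |].
- by apply: measurable_funTS; exact: measurable_dquot.
- exact: measurable_funTS.
- move=> z _; rewrite dquot_ge0 /= ler_wpM2r ?invr_ge0 ?powR_ge0//.
  by have /andP[] := pw z.
- apply: le_lt_trans uoo; apply: ge0_le_integral; [exact: mQ| | | |].
  + move=> z _; rewrite lee_fin divr_ge0 ?powR_ge0//.
    by have /andP[+ _] := pw z; apply: le_trans; exact: powR_ge0.
  + by apply/measurable_EFinP; exact: measurable_funTS.
  + by apply/measurable_EFinP/measurable_funTS; exact: measurable_dquot.
  + move=> z _; rewrite lee_fin ler_wpM2r ?invr_ge0 ?powR_ge0//.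
    by have /andP[] := pw z.
Qed.

(** Covers both sources: [a = lambda], [b = - gamma] for the singular one, [a = 1], [b = q - 1] for
    the critical one. *)
Lemma excess_sources_integral a b h k : 0 <= a -> b <= q - 1 -> 1 <= h < k ->
  (\int[lebesgue_Rn]_x (excess u h x `^ q)%:E < +oo)%E ->
  \int[lebesgue_Rn]_(x in Omega) (a * (`|u x| `^ b * excess u k x)) <=
  a * ((k / (k - h)) `^ q * \int[lebesgue_Rn]_x (excess u h x `^ q)).
Proof.
have /(X0P s mOmega p_gt1)[mu _ _ _] := uX0.
move=> a0 bq hk hoo; have mh : measurable_fun setT (fun x => excess u h x `^ q).
  exact: measurableT_comp (measurable_powR q) (measurable_excess h mu).
have ih : lebesgue_Rn.-integrable setT (fun x => (excess u h x `^ q)%:E).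
  apply/integrableP; split; first exact/measurable_EFinP.
  by under eq_integral do rewrite gee0_abs ?lee_fin ?powR_ge0//.
have c0 : 0 <= a * (k / (k - h)) `^ q by rewrite mulr_ge0 ?powR_ge0.
rewrite mulrA -RintegralZl; [|exact: measurableT|exact: ih].
rewrite Rintegral_mkcond; apply: ge0_le_Rintegral; [exact: measurableT| | | |].
- apply/(measurable_restrictT _ mOmega)/measurable_funTS.
  apply: measurable_funM; first exact: measurable_cst.
  apply: measurable_funM; last exact: measurable_excess.
  apply: (measurableT_comp (measurable_powR b)).
  exact: measurableT_comp.
- exact: measurable_funM.
- move=> x _; rewrite patchE; case: ifPn => _; last first.
    by rewrite lexx mulr_ge0 ?powR_ge0.
  have /andP[f0 fg] := excess_source_le u x bq q_ge1 hk.
  by rewrite mulr_ge0//= -mulrA ler_wpM2l.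
- under eq_integral do rewrite EFinM.
  rewrite ge0_integralZl; [|exact: measurableT| | |].
  + by rewrite lte_mul_pinfty.
  + exact/measurable_EFinP.
  + by move=> x _; rewrite lee_fin powR_ge0.
  + by rewrite lee_fin.
Qed.

(** Here [m] stands for the Kirchhoff coefficient [M(||u||^p)]. The pairing is bounded below by
    coercivity, and each source is at most its coefficient times one common majorant, whence the
    factor [lambda + 1]. *)
Lemma caccioppoli h k : 1 <= h < k ->
  (\int[lebesgue_Rn]_x (excess u h x `^ q)%:E < +oo)%E ->
  m * plap_pairing Omega s p u (excess u k)
    - \int[lebesgue_Rn]_(x in Omega)
        (lambda / (`|u x| `^ (gamma - 1) * u x) * excess u k x)
    - \int[lebesgue_Rn]_(x in Omega)
        (`|u x| `^ (q - 2) * u x * excess u k x) = 0 ->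
  m * \int[@lebesgue_Rn2 R N]_(z in Qset Omega) dq (excess u k) z <=
  (lambda + 1) * ((k / (k - h)) `^ q * \int[lebesgue_Rn]_x (excess u h x `^ q)).
Proof.
have /(X0P s mOmega p_gt1)[mu _ _ _] := uX0.
move=> hk hoo.
have k0 : 0 <= k by lra.
rewrite (@eq_Rintegral _ _ _ _ Omega (fun x =>
    lambda * (`|u x| `^ (- gamma) * excess u k x))); last first.
  by move=> x _; exact: singular_source_excess.
rewrite [X in _ - X](@eq_Rintegral _ _ _ _ Omega (fun x =>
    1 * (`|u x| `^ (q - 1) * excess u k x))); last first.
  by move=> x _; rewrite mul1r; exact: critical_source_excess.
move=> weak.
have bg : - gamma <= q - 1.
  by rewrite (@le_trans _ _ 0) ?oppr_le0 ?subr_ge0.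
apply: le_trans (ler_wpM2l m_ge0 (plap_pairing_excess k)) _.
move: weak; rewrite -addrA -opprD => /eqP; rewrite subr_eq0 => /eqP ->.
rewrite mulrDl lerD//; first exact: excess_sources_integral.
exact: excess_sources_integral.
Qed.

End caccioppoli.

(** * De Giorgi iteration *)

Lemma powR_exprAC (R : realType) (x r : R) n :
  0 <= x -> (x ^+ n) `^ r = (x `^ r) ^+ n.
Proof.
by move=> x0; rewrite -(powR_mulrn _ x0) -(powR_mulrn _ (powR_ge0 _ _)) powRAC.
Qed.

Lemma gt1_powR_gt1 (R : realType) (x r : R) : 1 < x -> 0 < r -> 1 < x `^ r.
Proof.
move=> x1 r0; rewrite -[ltLHS](congr1 (@^~ r) (powR1 R)).
by apply: gt0_ltr_powR; rewrite ?nnegrE ?(ltW (lt_trans _ x1)).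
Qed.

Lemma le_geometric_eq0 (R : realType) (t e r : R) :
  0 <= t -> 0 <= r < 1 -> (forall n, t <= e * r ^+ n) -> t = 0.
Proof.
move=> t0 /andP[r0 r1] tn; apply/eqP; rewrite eq_le t0 andbT.
have rcvg : (fun n => e * r ^+ n) @ \oo --> (e * 0 : R).
  by apply: cvgMr; apply: cvg_expr; rewrite ger0_norm.
rewrite -[leRHS](mulr0 e) -(cvg_lim _ rcvg)//.
by apply: limr_ge; [exact: cvgP rcvg|exact: nearW].
Qed.

(** Consecutive levels differ by [K 2^-n / 2] while [k n.+1 <= 2 K], so the ratio grows only
    geometrically. *)
Lemma dyadic_levels (R : realFieldType) (K : R) n : 1 <= K ->
  let k m : R := K * (2 - 2 ^- m) in
  1 <= k n < k n.+1 /\ k n.+1 / (k n.+1 - k n) <= 4 * 2 ^+ n.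
Proof.
move=> K1 k; have K0 : 0 < K := lt_le_trans ltr01 K1.
have xy : 2 ^- n * 2 ^+ n = 1 :> R by rewrite mulVf// expf_eq0 pnatr_eq0 andbF.
have y1 : 1 <= 2 ^+ n :> R by rewrite exprn_ege1// ler1n.
have kS : k n.+1 = K * (2 - 2 ^- n / 2) by rewrite /k exprSr invfM.
rewrite {}kS {}/k; move: (2 ^+ n) (2 ^- n) xy y1 => y x xy y1.
have x0 : 0 < x by nra.
have x1 : x <= 1 by nra.
have dk : K * (2 - x / 2) - K * (2 - x) = K * x / 2 by field.
have Kx : 0 < K * x by rewrite mulr_gt0.
split; first by apply/andP; split; nra.
rewrite dk ler_pdivrMr ?divr_gt0//.
have -> : 4 * y * (K * x / 2) = 2 * K * (x * y) by field.
by rewrite xy; nra.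
Qed.

(* With [k_n = K (2 - 2^-n)] and [eta = 2^(- beta / (alpha - 1))], the
   recursion gives [A k_n <= e eta^n] as soon as [A K] is at most the [e] for
   which [C 4^beta e^(alpha - 1) = eta]. *)
Lemma de_giorgi (R : realType) (A : R -> R) (C alpha beta : R) :
  0 < C -> 1 < alpha -> 0 < beta ->
  (forall k, 0 <= A k) -> (forall h k, 1 <= h <= k -> A k <= A h) ->
  (forall h k, 1 <= h < k ->
    A k <= C * (k / (k - h)) `^ beta * A h `^ alpha) ->
  (forall e, 0 < e -> exists2 K, 1 <= K & A K <= e) ->
  exists2 K, 1 <= K & A K = 0.
Proof.
move=> C0 alpha1 beta0 A0 A_decr A_rec A_small.
pose delta := alpha - 1; have delta0 : 0 < delta by rewrite subr_gt0.
pose B : R := 2 `^ beta; pose C' := C * 4 `^ beta.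
have B0 : 0 < B by rewrite powR_gt0.
have B1 : 1 < B by rewrite gt1_powR_gt1// ltr1n.
have C'0 : 0 < C' by rewrite mulr_gt0// powR_gt0.
pose eta := B `^ (- delta^-1).
have eta0 : 0 < eta by rewrite powR_gt0.
have eta1 : eta < 1.
  by rewrite /eta powRN invf_lt1 ?powR_gt0// gt1_powR_gt1// invr_gt0.
have eta_delta : eta `^ delta = B^-1.
  by rewrite -powRrM mulNr mulVf ?gt_eqF// powRN powRr1// ltW.
pose e := (eta / C') `^ delta^-1.
have e0 : 0 < e by rewrite powR_gt0// divr_gt0.
have e_delta : e `^ delta = eta / C'.
  by rewrite -powRrM mulVf ?gt_eqF// powRr1// ltW// divr_gt0.
clearbody e eta; have [K K1 AK] := A_small e e0.
have K0 : 0 < K := lt_le_trans ltr01 K1.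
pose k n : R := K * (2 - 2 ^- n).
have kP n := dyadic_levels n K1.
have k_le n : 1 <= k n < k n.+1 by have [] := kP n.
have ratio n : k n.+1 / (k n.+1 - k n) <= 4 * 2 ^+ n by have [] := kP n.
have Ak n : A (k n) <= e * eta ^+ n.
  elim: n => [|n IH].
    by rewrite /k !expr0 invr1 mulr1 (_ : K * _ = K)//; ring.
  apply: le_trans (A_rec _ _ (k_le n)) _.
  have /andP[kn1 kn2] := k_le n.
  have h1 : (k n.+1 / (k n.+1 - k n)) `^ beta <= 4 `^ beta * B ^+ n.
    rewrite -powR_exprAC// -powRM// ?exprn_ge0//.
    apply: ge0_ler_powR; rewrite ?nnegrE; [exact: ltW| | |exact: ratio].
      rewrite divr_ge0 ?subr_ge0 ?(ltW kn2)//.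
      exact: le_trans (le_trans ler01 kn1) (ltW kn2).
    exact/mulr_ge0/exprn_ge0.
  have en0 : 0 < e * eta ^+ n by rewrite mulr_gt0 ?exprn_gt0.
  have alpha0 : 0 < alpha := lt_trans ltr01 alpha1.
  (* One factor of the induction bound is kept. Its remaining power [alpha - 1] yields [eta / C'],
     which cancels [C'] and advances the geometric rate, and [B^-n], which cancels the growth of the
     ratio. *)
  have h2 : A (k n) `^ alpha <= e * eta ^+ n * (eta / C' * B^-1 ^+ n).
    have <- : (e * eta ^+ n) `^ (alpha - 1) = eta / C' * B^-1 ^+ n.
      rewrite powRM ?exprn_ge0 ?(ltW e0) ?(ltW eta0)//.
      by rewrite powR_exprAC ?(ltW eta0)// e_delta eta_delta.
    rewrite mulr_powRB1 ?(ltW en0)//.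
    by apply: ge0_ler_powR; rewrite ?nnegrE ?(ltW alpha0) ?(ltW en0).
  apply: (@le_trans _ _ (C * (4 `^ beta * B ^+ n) *
      (e * eta ^+ n * (eta / C' * B^-1 ^+ n)))).
    apply: ler_pM => //; rewrite ?mulr_ge0 ?powR_ge0 ?(ltW C0)//.
    by rewrite ler_pM2l.
  have Bn : B ^+ n * B^-1 ^+ n = 1 by rewrite -exprMn divff ?gt_eqF// expr1n.
  rewrite (_ : _ * _ = (C * 4 `^ beta / C') * (B ^+ n * B^-1 ^+ n) *
      (e * (eta * eta ^+ n))); last by ring.
  by rewrite Bn divff ?gt_eqF// !mul1r exprS.
(* All levels stay below [2 * K], so [A (2 * K) <= A (k n) <= e eta^n] for every [n]. *)
exists (2 * K); first by rewrite (le_trans K1)// ler_pMl// ler1n.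
apply: (@le_geometric_eq0 _ _ e eta) => // [|n]; first by rewrite (ltW eta0).
apply: le_trans (Ak n); apply: A_decr.
have /andP[-> _] := k_le n; rewrite /k.
by rewrite mulrC ler_pM2r// gerBl invr_ge0 exprn_ge0.
Qed.

(** Dominated convergence along integer levels: the truncations vanish at [x] once the level exceeds
    [u x], and the one at level 0 dominates. *)
Lemma excess_integral_small d (T : measurableType d) (R : realType)
    (mu : {measure set T -> \bar R}) (u : T -> R) (q e : R) :
  measurable_fun setT u -> 0 < q ->
  (\int[mu]_x (excess u 0 x `^ q)%:E < +oo)%E -> 0 < e ->
  exists2 K, 1 <= K & \int[mu]_x (excess u K x `^ q) <= e.
Proof.
move=> mu_ q0 u_lty e0.
have mw k : measurable_fun setT (fun x => (excess u k x `^ q)%:E).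
  apply/measurable_EFinP.
  exact: measurableT_comp (measurable_powR q) (measurable_excess k mu_).
have i0 : mu.-integrable setT (fun x => (excess u 0 x `^ q)%:E).
  apply/integrableP; split; first exact: mw.
  by under eq_integral do rewrite gee0_abs ?lee_fin ?powR_ge0//.
have : (\int[mu]_x (excess u n.+1%:R x `^ q)%:E)%E @[n --> \oo] -->
    (\int[mu]_x (cst 0 x : \bar R))%E.
  apply: (@dominated_cvg _ _ _ mu _ measurableT _ _
      (fun x => (excess u 0 x `^ q)%:E)).
  - by move=> n; exact: mw.
  - move=> x _; apply: cvg_near_cst; near=> n; congr EFin.
    rewrite /excess max_r ?powR0 ?gt_eqF// subr_le0.
    apply/ltW/(@lt_le_trans _ _ (Num.truncn (u x)).+1%:R); first exact: truncnS_gt.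
    by rewrite ler_nat ltnS; near: n; exact: nbhs_infty_ge.
  - by [].
  - exact: i0.
  - move=> n x _; rewrite gee0_abs ?lee_fin ?powR_ge0//.
    apply: ge0_ler_powR; rewrite ?nnegrE ?excess_ge0 ?(ltW q0)//.
    exact: excess_le.
rewrite integral0 => /fine_cvgP[_ cvg0].
have [n _ /(_ n (leqnn n)) /= ne] := cvgr_le (0 : R) cvg0 _ e0.
by exists n.+1%:R => //; rewrite ler1n.
Unshelve. all: by end_near. Qed.

(** * Essential boundedness of the solution *)

Lemma Lfun_on_closure_bounded (R : realType) (N : nat) (Omega : set (Rn R N))
    (u : Rn R N -> R) (K : R) :
  measurable_fun setT u -> 0 <= K -> {ae lebesgue_Rn, forall x, `|u x| <= K} ->
  Lfun_on lebesgue_Rn +oo%E (closure Omega) u.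
Proof.
move=> mu K0 uK.
have mcl : measurable (closure Omega).
  rewrite -[X in measurable X]setCK; apply/measurableC/Rn_open_measurable.
  exact/closed_openC/closed_closure.
apply/andP; split; rewrite inE/=.
  by apply/(measurable_restrictT _ mcl)/measurable_funTS.
rewrite /finite_norm unlock; case: ifPn => // _.
apply: (@le_lt_trans _ _ K%:E); last exact: ltry.
apply/ess_supP; apply: filterS uK => x uxK /=.
by rewrite lee_fin patchE; case: ifPn => // _; rewrite normr0.
Qed.

Theorem lemma5p5 (R : realType) (N : nat) (Omega : set (Rn R N))
    (s p gamma lambda theta m0 : R) (M : R -> R) (u : Rn R N -> R)
    (hN : (2 <= N)%N)
    (hOmega : bounded_domain Omega) (hLip : lipschitz_boundary Omega)
    (hs : 0 < s < 1) (hp : 1 < p) (hps : p * s < N%:R)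
    (hgamma : 0 < gamma < 1) (hlambda : 0 < lambda)
    (M_ge0 : forall t, 0 <= t -> 0 <= M t)
    (m1_continuous : {within `[0, +oo[, continuous M})
    (m1_theta : 1 < theta < critical_exponent N s p / p)
    (m1 : forall t, 0 <= t -> t * M t <= theta * primitive0 M t)
    (m0_gt0 : 0 < m0)
    (m2 : forall t, 0 <= t <= 1 -> m0 * t `^ (theta - 1) <= M t)
    (m3 : forall tau, 0 < tau ->
      exists2 kappa, 0 < kappa & forall t, tau <= t -> kappa <= M t)
    (u_sol : weak_solution Omega s p M gamma lambda u)
    (u_gt0 : {ae lebesgue_Rn, forall x, Omega x -> 0 < u x}) :
  Lfun_on lebesgue_Rn +oo%E (closure Omega) u.
Proof.
have [_ oOmega _ _] := hOmega; have mOmega := Rn_open_measurable oOmega.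
have [uX0 u_weak] := u_sol.
have N_gt0 : (0 < N)%N by exact: leq_trans hN.
have n_gt0 : 0 < N%:R :> R by rewrite ltr0n.
have p_gt0 : 0 < p := lt_trans ltr01 hp.
have ps_gt0 : 0 < p * s by case/andP: hs => s0 _; exact: mulr_gt0.
have d_gt0 : 0 < N%:R - p * s by rewrite subr_gt0.
pose q := critical_exponent N s p.
have critE : critical_exponent N s p = q by [].
have qE : q = N%:R * p / (N%:R - p * s) by [].
have q_gt0 : 0 < q by rewrite qE divr_gt0// mulr_gt0.
have qp : 1 < q / p.
  rewrite (_ : q / p = N%:R / (N%:R - p * s)); last first.
    by rewrite qE; field; rewrite !gt_eqF.
  by rewrite ltr_pdivlMr// mul1r gtrBl.
have q_ge1 : 1 <= q.
  by move: qp; rewrite ltr_pdivlMr// mul1r => /(lt_trans hp)/ltW.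
(* The scaling relation of the Sobolev inequality with [sigma = p * s]. It characterises the
   critical exponent. *)
have pqE : p + q * (p * s) / N%:R = q by rewrite qE; field; rewrite !gt_eqF.
clearbody q.
have /(X0P s mOmega hp)[mu u_p u_dq u_ae] := uX0.
have mw k := measurable_excess k mu.
pose dq (w : Rn R N -> R) := dquot p (N%:R + p * s) w.
pose E k := \int[@lebesgue_Rn2 R N]_(z in Qset Omega) dq (excess u k) z.
pose A k := \int[lebesgue_Rn]_x (excess u k x `^ q).
pose S := sobolev_cst N%:R p q (p * s) (Num.sqrt N%:R : R).
have S0 : 0 < S by rewrite sobolev_cst_gt0// sqrtr_gt0.
have Efin k : (\int[@lebesgue_Rn2 R N]_(z in Qset Omega)
    (dq (excess u k) z)%:E = (E k)%:E)%E.
  rewrite /E /Rintegral fineK// ge0_fin_numE.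
    exact: le_lt_trans (integral_dquot_excess s mOmega hp k mu) u_dq.
  by apply: integral_ge0 => z _; rewrite lee_fin dquot_ge0.
have E_ge0 k : 0 <= E k by apply: Rintegral_ge0 => z _; exact: dquot_ge0.
have A_ge0 k : 0 <= A k by apply: Rintegral_ge0 => x _; exact: powR_ge0.
have excess_sobolev k e : 0 <= k -> E k <= e ->
    (\int[lebesgue_Rn]_x (excess u k x `^ q)%:E <= ((S * e) `^ (q / p))%:E)%E.
  move=> k0 Ek; apply: (@sobolev _ _ Omega p q (p * s)) => //.
  - by move=> x; exact: excess_ge0.
  - exact: excess_ae0.
  - have := X0_integral_lty mOmega hp (X0_excess mOmega hp k0 uX0).
    by under eq_integral do rewrite (ger0_norm (excess_ge0 _ _ _)).
  - by rewrite -/(dq _) Efin lee_fin.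
(* Sobolev with [e := E k] places every truncation at a level [k >= 0] in [L^q], so that [A] takes
   no default value there. *)
have excess_lty k : 0 <= k ->
    (\int[lebesgue_Rn]_x (excess u k x `^ q)%:E < +oo)%E.
  move=> k0; apply: le_lt_trans (excess_sobolev k _ k0 (lexx _)) _.
  exact: ltry.
have Afin k : 0 <= k ->
    (\int[lebesgue_Rn]_x (excess u k x `^ q)%:E = (A k)%:E)%E.
  move=> k0; rewrite /A /Rintegral fineK// ge0_fin_numE; first exact: excess_lty.
  by apply: integral_ge0 => x _; rewrite lee_fin powR_ge0.
have A_sobolev k e : 0 <= k -> E k <= e -> A k <= (S * e) `^ (q / p).
  by move=> k0 Ek; rewrite -lee_fin -Afin//; exact: excess_sobolev.
have [K K1 AK] : exists2 K, 1 <= K & A K = 0.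
  pose m := M (X0norm Omega s p u `^ p).
  have m_ge0 : 0 <= m by apply: M_ge0; exact: powR_ge0.
  (* Degenerate case: by [m3] a vanishing coefficient forces the norm of [u] to vanish. Then
     [E 1 <= 0], and Sobolev gives [A 1 = 0]. *)
  have [m_eq0|m_neq0] := eqVneq m 0.
    exists 1 => //; apply/eqP; rewrite eq_le A_ge0 andbT.
    have norm0 : X0norm Omega s p u `^ p = 0.
      apply/eqP; rewrite eq_le powR_ge0 andbT leNgt; apply/negP => norm_gt0.
      have [kappa kappa0 /(_ _ (lexx _))] := m3 _ norm_gt0.
      by rewrite -/m m_eq0 leNgt kappa0.
    have E1 : E 1 <= 0.
      have := norm0; rewrite /X0norm -powRrM mulVf ?gt_eqF// powRr1; last first.
        by apply: Rintegral_ge0 => z _; exact: dquot_ge0.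
      move=> <-; rewrite -lee_fin -Efin /Rintegral fineK; last first.
        rewrite ge0_fin_numE; first exact: u_dq.
        by apply: integral_ge0 => z _; rewrite lee_fin dquot_ge0.
      exact: integral_dquot_excess.
    have := A_sobolev 1 0 ler01 E1.
    by rewrite mulr0 powR0// gt_eqF// (lt_trans ltr01).
  have m_gt0 : 0 < m by rewrite lt_neqAle eq_sym m_neq0.
  (* Dividing the Caccioppoli inequality by [m] and inserting it into Sobolev gives
     [A k <= (C (k / (k - h))^q A h)^(q / p)], the recursion with [alpha = q / p] and
     [beta = q * (q / p)]. *)
  pose C := S * (lambda + 1) / m.
  have C0 : 0 < C by rewrite divr_gt0// mulr_gt0// addr_gt0.
  apply: (@de_giorgi _ A (C `^ (q / p)) (q / p) (q * (q / p))).
  - by rewrite powR_gt0.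
  - exact: qp.
  - by rewrite mulr_gt0// (lt_trans ltr01).
  - exact: A_ge0.
  - move=> h k /andP[h1 hk]; have h0 := le_trans ler01 h1.
    apply: ge0_le_Rintegral; [exact: measurableT| | | |].
    + exact: measurableT_comp (measurable_powR q) (mw k).
    + exact: measurableT_comp (measurable_powR q) (mw h).
    + move=> x _; rewrite powR_ge0/=; apply: ge0_ler_powR;
        by rewrite ?nnegrE ?excess_ge0 ?(ltW q_gt0)// excess_le.
    + exact: excess_lty.
  - move=> h k hk; have /andP[h1 hk'] := hk; have h0 := le_trans ler01 h1.
    have k0 := le_trans h0 (ltW hk').
    have [_ weak_k] := u_weak _ (X0_excess mOmega hp k0 uX0).
    rewrite critE in weak_k.
    have gamma_ge0 : 0 <= gamma by case/andP: hgamma => /ltW.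
    have := caccioppoli mOmega hp q_ge1 gamma_ge0 (ltW hlambda) m_ge0 uX0 hk
      (excess_lty h h0) weak_k.
    rewrite -/(dq _) -/(E k) -/(A h) -ler_pdivlMl// => Ek.
    apply: le_trans (A_sobolev k _ k0 Ek) _.
    have Cc : 0 <= C * (k / (k - h)) `^ q.
      by rewrite mulr_ge0 ?powR_ge0 ?(ltW C0).
    rewrite (_ : S * _ = C * (k / (k - h)) `^ q * A h); last by rewrite /C; ring.
    by rewrite (powRM _ Cc (A_ge0 h)) (powRM _ (ltW C0) (powR_ge0 _ _)) -powRrM.
  - move=> e e0; exact: (excess_integral_small mu q_gt0 (excess_lty 0 (lexx 0)) e0).
have K0 : 0 <= K := le_trans ler01 K1.
apply: (@Lfun_on_closure_bounded _ _ _ _ K mu K0).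
have mwq : measurable_fun setT (fun x => (excess u K x `^ q)%:E).
  apply/measurable_EFinP; exact: measurableT_comp (measurable_powR q) (mw K).
have : (\int[lebesgue_Rn]_x `|(excess u K x `^ q)%:E| = 0)%E.
  under eq_integral do rewrite gee0_abs ?lee_fin ?powR_ge0//.
  by rewrite Afin// AK.
move=> /(ae_eq_integral_abs lebesgue_Rn measurableT mwq) w0.
(* Almost everywhere the excess over [K] is 0. Inside [Omega] positivity turns this into [|u| <= K],
   and outside [u] is 0. *)
move: w0 u_gt0 u_ae; apply: filterS3 => x /(_ I) [/powR_eq0_eq0 wx] ux0 uxO.
have [/ux0 ux|/uxO ->] := pselect (Omega x); last by rewrite normr0.
rewrite (gtr0_norm ux) -subr_le0 leNgt; apply/negP => uK.
by move: wx; rewrite /excess max_l ?(ltW uK)// => wx; rewrite wx ltxx in uK.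
Qed.
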